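(* Let $n, d \ge 1$ be integers and let $u_1, \ldots, u_n \in \mathbb{R}^d$ be unit vectors. Then there exists a unit vector $v \in \mathbb{R}^d$ such that $\langle u_i, v\rangle \neq 0$ for every $i \in \{1,\ldots,n\}$ and \[ \sum_{i=1}^n \frac{1}{\langle u_i, v\rangle^2} \le n^2 . \]
   Context: $\langle\cdot,\cdot\rangle$ is the standard Euclidean inner product on $\mathbb{R}^d$, and a unit vector is a vector of Euclidean norm $1$. The vectors $u_1,\ldots,u_n$ need not be distinct. *)

(* Defs.v *)
From mathcomp Require Import all_boot all_order all_algebra.
From mathcomp Require Import reals.

Set Implicit Arguments.
Unset Strict Implicit.
Unset Printing Implicit Defensive.

Import Order.TTheory GRing.Theory Num.Theory.

Local Open Scope ring_scope.

(* The canonical norm `|u| on row vectors is the sup norm, hence a separate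
   Euclidean norm; the library's dot product [dotmx] is only available over a
   numClosedFieldType. *)
Definition dotv (R : realType) (d : nat) (u v : 'rV[R]_d) : R :=
  \sum_(k < d) u 0 k * v 0 k.

Definition enorm (R : realType) (d : nat) (u : 'rV[R]_d) : R :=
  Num.sqrt (dotv u u).

Definition unit_vector (R : realType) (d : nat) (u : 'rV[R]_d) : Prop :=
  enorm u = 1.

(* Main.v *)
(* Let A be the Gram matrix of the u_i. A vector x with x_i (x A)_i = 1 for all
   i gives the unit vector v = n^(-1/2) sum_i x_i u_i, for which
   <u_i, v> = (n^(1/2) x_i)^-1, so the goal becomes |x|^2 <= n.
   If A is positive definite, every open orthant contains such an x (maximise
   the product of the coordinates subject to x A x^T <= 1). For these 2^n
   solutions the weights w_x = 1 / det(1 + D A D), D = diag(x), are positive and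
   satisfy the Euler-Jacobi type identities
     sum_x w_x = 1   and   A_kk sum_x w_x x_k^2 = 1,
   so |x|^2 has weighted mean sum_k 1 / A_kk <= n.
   The identities come from the multilinear polynomials
   Delta_x(t) = det(diag(t) + A D): at t = y A, y a solution, Delta_x vanishes
   unless y = x, so the coefficients of the Delta_x and the monomials at the
   points y A form, up to scaling, two mutually inverse matrices of size 2^n.
   A semidefinite A is the limit of A + delta I. *)

Require Import Defs.
From mathcomp Require Import boolp classical_sets functions reals topology.
From mathcomp Require Import normedtype derive.
From mathcomp Require Import all_boot all_order all_algebra fingroup perm.
From mathcomp Require Import ring lra.

Import Order.TTheory GRing.Theory Num.Theory.
Import numFieldNormedType.Exports.

Local Open Scope ring_scope.

(** * Expansion of determinants and the identities satisfied by the solutions *)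

Section Algebra.
Variables (F : fieldType) (n : nat).
Implicit Types (M : 'M[F]_n) (t : 'rV[F]_n) (S T P : {set 'I_n}).

(** The principal minor of [M] on the complement of [S], as the Leibniz sum of [M] with the rows in
    [S] replaced by identity rows; this avoids submatrices. *)
Definition det_coef M S : F :=
  \sum_(s : 'S_n) (-1) ^+ s * \prod_i (if i \in S then (i == s i)%:R else M i (s i)).

Lemma det_diag_addE t M :
  \det (diag_mx t + M) = \sum_(S : {set 'I_n}) (\prod_(i in S) t 0 i) * det_coef M S.
Proof.
under [RHS]eq_bigr do rewrite mulr_sumr.
rewrite exchange_big /=; apply: eq_bigr => s _.
under eq_bigr do rewrite !mxE.
rewrite bigA_distr mulr_sumr; apply: eq_bigr => S _.
rewrite mulrCA; congr (_ * _); rewrite [X in X * _]big_mkcond -big_split /=.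
by apply: eq_bigr => i _; case: ifP; rewrite ?mul1r ?mulr_natr.
Qed.

Lemma perm_fix_all_but1 (k : 'I_n) (s : 'S_n) : (forall i, i != k -> s i = i) -> s = 1%g.
Proof.
move=> sE; apply/permP => i; rewrite perm1.
have [->|/sE//] := eqVneq i k; apply/eqP/negPn/negP => /[dup] h /sE /perm_inj.
by move/eqP: h.
Qed.

Lemma det_coefT M : det_coef M setT = 1.
Proof.
rewrite /det_coef (bigD1 1%g) //= odd_perm1 expr0 mul1r.
rewrite big1 => [|i _]; last by rewrite inE perm1 eqxx.
rewrite big1 ?addr0 // => s s1; apply/eqP; rewrite mulf_eq0; apply/orP; right.
have [i si] : exists i, s i != i.
  apply/existsP; apply: contraR s1 => /existsPn h; apply/eqP/permP => i.
  by rewrite perm1; apply/eqP; move: (h i); rewrite negbK.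
by apply/prodf_eq0; exists i => //; rewrite inE [i == _]eq_sym (negPf si).
Qed.

Lemma det_coefD1 M k : det_coef M (setT :\ k) = M k k.
Proof.
rewrite /det_coef (bigD1 1%g) //= odd_perm1 expr0 mul1r.
rewrite (bigD1 k) //= big1 => [|i ik]; last by rewrite !inE ik perm1 eqxx.
rewrite !inE eqxx perm1 mulr1.
rewrite big1 ?addr0 // => s s1; apply/eqP; rewrite mulf_eq0; apply/orP; right.
have [i ik si] : exists2 i, i != k & s i != i.
  suff /exists_inP[i ? ?] : [exists i in [pred i | i != k], s i != i] by exists i.
  apply: contraR s1 => /exists_inPn h; apply/eqP/(perm_fix_all_but1 k) => i ik.
  by apply/eqP; move: (h i ik); rewrite negbK.
by apply/prodf_eq0; exists i => //; rewrite !inE ik [i == s i]eq_sym (negPf si).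
Qed.

(** A one-sided inverse of a square matrix is two-sided. *)
Lemma biorthogonalC (I : finType) (f g : I -> I -> F) :
  (forall a b, \sum_c f a c * g c b = (a == b)%:R) ->
  forall s t : I, \sum_a g s a * f a t = (s == t)%:R.
Proof.
move=> fg s t.
pose mx (h : I -> I -> F) := \matrix_(a < #|I|, b < #|I|) h (enum_val a) (enum_val b).
have mxM h k a b : (mx h *m mx k) (enum_rank a) (enum_rank b) = \sum_c h a c * k c b.
  rewrite mxE (reindex (@enum_rank I)) /=; last exact/onW_bij/enum_rank_bij.
  by apply: eq_bigr => c _; rewrite !mxE !enum_rankK.
have /mulmx1C gf : mx f *m mx g = 1%:M.
  apply/matrixP => a b; rewrite -[a]enum_valK -[b]enum_valK mxM fg mxE.
  by rewrite (inj_eq enum_rank_inj).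
by rewrite -mxM gf mxE (inj_eq enum_rank_inj).
Qed.

Variables (A : 'M[F]_n) (p : {set 'I_n} -> 'rV[F]_n).
Hypothesis p_sol : forall S j, p S 0 j * (p S *m A) 0 j = 1.
Hypothesis p_inj : injective p.

Let J S := \det (diag_mx (p S *m A) + A *m diag_mx (p S)).

Lemma det_neq_sol S T : S != T ->
  \det (diag_mx (p T *m A) + A *m diag_mx (p S)) = 0.
Proof.
(* The difference of the two solutions lies in the left kernel. *)
move=> neqST; apply/eqP/det0P; exists (p T - p S).
  by rewrite subr_eq0; apply: contra neqST => /eqP/p_inj ->.
apply/rowP => j; rewrite mulmxDr mulmxA !mul_mx_diag mulmxBl !mxE.
have := p_sol T j; have := p_sol S j; rewrite !mxE; set a := \sum_k _; set b := \sum_k _.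
by move=> h1 h2; rewrite mulrBl h2 mulrBl [a * _]mulrC h1; ring.
Qed.

Hypothesis J_neq0 : forall S, J S != 0.

(** Subsets index both the solutions and the monomials, so the matrices are square. Summing over
    monomials first evaluates the determinant of [P] at solution [Q], which vanishes for [P != Q];
    [biorthogonalC] swaps the order. *)
Lemma sol_biorthogonal S T :
  \sum_P det_coef (A *m diag_mx (p P)) S / J P * (\prod_(i in T) (p P *m A) 0 i)
    = (S == T)%:R.
Proof.
apply: (@biorthogonalC _ (fun P T => \prod_(i in T) (p P *m A) 0 i)
  (fun S P => det_coef (A *m diag_mx (p P)) S / J P)) => P Q.
under eq_bigr do rewrite mulrA.
rewrite -mulr_suml -det_diag_addE.
have [<-|PQ] := eqVneq P Q; first by rewrite divff // J_neq0.
by rewrite det_neq_sol ?mul0r // eq_sym.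
Qed.

(** Multiplying the matrix of [J P] on the left by D = [diag_mx (p P)] gives 1 + D A D, so this is 1
    / det(1 + D A D). *)
Let w P := (J P * \prod_i p P 0 i)^-1.

Lemma sol_neq0 P i : p P 0 i != 0.
Proof.
by apply/eqP => p0; have /eqP := p_sol P i; rewrite p0 mul0r eq_sym oner_eq0.
Qed.

Lemma prod_sol P : \prod_i (p P *m A) 0 i = (\prod_i p P 0 i)^-1.
Proof.
rewrite -prodfV; apply: eq_bigr => i _; apply: (mulfI (sol_neq0 P i)).
by rewrite p_sol divff ?sol_neq0.
Qed.

(** The diagonal entry at [setT], where the coefficient is 1. *)
Lemma sol_weight_sum1 : \sum_P w P = 1.
Proof.
have := sol_biorthogonal setT setT; rewrite eqxx mulr1n => <-.
apply: eq_bigr => P _; rewrite det_coefT mul1r /w invfM -prod_sol.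
by congr (_ * _); apply: eq_bigl => i; rewrite inE.
Qed.

(** The diagonal entry at [setT :\ k]: the coefficient contributes [A k k] times x_k, and the
    missing factor (x A)_k = 1 / x_k a second x_k. *)
Lemma sol_weight_sum_sqr k : A k k * \sum_P w P * p P 0 k ^+ 2 = 1.
Proof.
have := sol_biorthogonal (setT :\ k) (setT :\ k); rewrite eqxx mulr1n => <-.
rewrite mulr_sumr; apply: eq_bigr => P _.
rewrite det_coefD1 mul_mx_diag mxE /w invfM -prod_sol (bigD1 k) //=.
rewrite [X in _ = _ * X](eq_bigl (fun i => i != k)) => [|i]; last by rewrite !inE andbT.
by have := p_sol P k; set a := (_ *m _) 0 k => pa; ring: pa.
Qed.
End Algebra.

(** * The dot product and positive definite matrices *)

Section Dot.
Variables (R : realType) (n : nat).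
Implicit Types (x y z : 'rV[R]_n) (A M : 'M[R]_n).

Lemma dotvDl x y z : dotv (x + y) z = dotv x z + dotv y z.
Proof. by rewrite /dotv -big_split; apply: eq_bigr => i _; rewrite mxE mulrDl. Qed.

Lemma dotvC x y : dotv x y = dotv y x.
Proof. by apply: eq_bigr => i _; rewrite mulrC. Qed.

Lemma dotvDr x y z : dotv x (y + z) = dotv x y + dotv x z.
Proof. by rewrite dotvC dotvDl ![dotv _ x]dotvC. Qed.

Lemma dotvZl a x y : dotv (a *: x) y = a * dotv x y.
Proof. by rewrite mulr_sumr; apply: eq_bigr => i _; rewrite mxE mulrA. Qed.

Lemma dotvZr a x y : dotv x (a *: y) = a * dotv x y.
Proof. by rewrite dotvC dotvZl dotvC. Qed.

Lemma dotvE m (x y : 'rV[R]_m) : dotv x y = (x *m y^T) 0 0.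
Proof. by rewrite mxE; apply: eq_bigr => i _; rewrite !mxE. Qed.

Lemma dotv_mulmx m (x : 'rV[R]_m) (B : 'M[R]_(m, n)) y :
  dotv (x *m B) y = dotv x (y *m B^T).
Proof. by rewrite !dotvE trmx_mul trmxK mulmxA. Qed.

Lemma dotv_delta x j : dotv x (delta_mx 0 j) = x 0 j.
Proof.
rewrite /dotv (bigD1 j) //= mxE !eqxx mulr1 big1 ?addr0 // => i ij.
by rewrite mxE (negPf ij) andbF mulr0.
Qed.

Lemma dotvv x : dotv x x = \sum_i x 0 i ^+ 2.
Proof. by []. Qed.

Lemma dotvv_ge0 x : 0 <= dotv x x.
Proof. by apply: sumr_ge0 => i _; rewrite -expr2 sqr_ge0. Qed.

Lemma dotvv_gt0 x : x != 0 -> 0 < dotv x x.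
Proof.
move=> x0; rewrite lt_neqAle dotvv_ge0 andbT eq_sym; apply: contra x0.
rewrite dotvv psumr_eq0 => [/allP h|i _]; last exact: sqr_ge0.
apply/eqP/rowP => i; rewrite mxE; apply/eqP.
by have := h i; rewrite mem_index_enum sqrf_eq0 => /(_ isT).
Qed.

Definition posdef A := forall x, x != 0 -> 0 < dotv x (x *m A).

Lemma posdef_det_gt0 A : posdef A -> 0 < \det A.
Proof.
(* The determinant has no zero on the segment from A to the identity. *)
move=> Apos; rewrite ltNge; apply/negP => detA.
pose p : {poly R} := \det ('X%:M + (1 - 'X) *: map_mx polyC A).
have pE s : p.[s] = \det (s%:M + (1 - s) *: A).
  rewrite -horner_evalE -det_map_mx; congr (\det _); apply/matrixP => i j.
  by rewrite !mxE /= horner_evalE hornerD hornerM hornerMn !hornerE.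
have [|s /andP[s0 s1]] := @poly_ivt _ p 0 1 ler01.
  by rewrite !pE raddf0 add0r subr0 subrr !scale1r scale0r addr0 det1 detA ler01.
rewrite /root pE => /det0P[x x0 xs]; have := dotvv_gt0 _ x0; have := Apos x x0.
have : dotv x (x *m (s%:M + (1 - s) *: A)) = 0.
  by rewrite xs /dotv big1 // => i _; rewrite mxE mulr0.
rewrite mulmxDr mul_mx_scalar -scalemxAr dotvDr !dotvZr; nra.
Qed.

Lemma dotv_diag x y z : dotv x (y *m diag_mx z) = dotv (x *m diag_mx z) y.
Proof. by rewrite dotv_mulmx tr_diag_mx. Qed.

(** With D = [diag_mx x] the product is det(1 + D A D), and the form of 1 + D A D at y is |y|^2 plus
    the form of A at y D. *)
Lemma posdef_weight_gt0 A x : posdef A -> (forall i, x 0 i * (x *m A) 0 i = 1) ->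
  0 < \det (diag_mx (x *m A) + A *m diag_mx x) * \prod_i x 0 i.
Proof.
move=> Apos xA; rewrite mulrC -det_diag -det_mulmx mulmxDr mulmxA mulmx_diag.
have -> : diag_mx (\row_j (x 0 j * (x *m A) 0 j)) = 1%:M.
  by rewrite -diag_const_mx; congr diag_mx; apply/rowP => i; rewrite [LHS]mxE xA !mxE.
apply: posdef_det_gt0 => y y0.
rewrite mulmxDr mulmx1 !mulmxA dotvDr dotv_diag ltr_pwDl ?dotvv_gt0 //.
have [->|/Apos/ltW//] := eqVneq (y *m diag_mx x) 0.
by rewrite mul0mx /dotv big1 // => i _; rewrite mxE mul0r.
Qed.
End Dot.

(** * Tools from analysis: interior minima, compactness, continuity *)

Lemma poly_min_deriv0 (R : realType) (p : {poly R}) (a b c : R) :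
  a < c < b -> (forall x, a < x < b -> p.[c] <= p.[x]) -> p^`().[c] = 0.
Proof.
move=> /[dup] acb /andP[ac cb] pmin.
have d0 : is_derive c (1 : R) (horner p) 0.
  apply: (@derive1_at_min _ _ a b); first exact/ltW/(lt_trans ac).
  - by move=> t _; exact: derivable_horner.
  - by rewrite in_itv.
  - by move=> t; rewrite in_itv /=; exact: pmin.
(* The analytic derivative, zero by Fermat's rule, equals the formal one. *)
by case: d0 => _ <-; case: (is_derive_poly p c) => _ ->.
Qed.

Section EVT.
Local Open Scope classical_set_scope.

(** Serves twice: with [g] a quadratic form, to maximise the product of coordinates, and with [g]
    the squared norm, to pass to semidefinite matrices. *)
Lemma EVT_box (R : realType) (n : nat) (f g : 'rV[R]_n -> R) (a b c : R) :
  continuous f -> continuous g ->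
  (exists2 x : 'rV[R]_n, forall i, a <= x 0 i <= b & g x <= c) ->
  exists x : 'rV[R]_n, [/\ forall i, a <= x 0 i <= b, g x <= c &
    forall y : 'rV[R]_n, (forall i, a <= y 0 i <= b) -> g y <= c -> f x <= f y].
Proof.
move=> fc gc [x0 x0box x0c].
pose K := [set x : 'rV[R]_n | forall i, `[a, b] (x ord0 i)] `&` [set x | g x <= c].
have KE x : K x <-> (forall i, a <= x 0 i <= b) /\ g x <= c.
  by split=> -[xab xc]; split=> // i; have := xab i; rewrite /= in_itv.
have Kc : compact K.
  apply: compact_closedI.
    by apply: (@rV_compact _ _ (fun=> `[a, b])) => _; exact: segment_compact.
  by apply: (@preimage_closed _ _ g [set y | y <= c]); [move=> x _; exact: gc|exact: closed_le].
have [||x /set_mem/KE[xab xc] xmin] := @EVT_min_rV R n f K _ Kc.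
- by exists x0; apply/KE.
- exact: continuous_subspaceT.
by exists x; split=> // y yab yc; apply: xmin; apply/mem_set/KE.
Qed.

End EVT.

Section Continuity.
Variables (R : realType) (n : nat).

Lemma continuous_sumr (I : Type) (r : seq I) (F : I -> 'rV[R]_n -> R) :
  (forall i, continuous (F i)) -> continuous (fun x => \sum_(i <- r) F i x).
Proof. by move=> Fc; apply: continuous_big => //; exact: add_continuous. Qed.

Lemma continuous_prodr (I : Type) (r : seq I) (F : I -> 'rV[R]_n -> R) :
  (forall i, continuous (F i)) -> continuous (fun x => \prod_(i <- r) F i x).
Proof. by move=> Fc; apply: continuous_big => //; exact: mul_continuous. Qed.

Lemma continuous_mulmx_coord (A : 'M[R]_n) j : continuous (fun x : 'rV[R]_n => (x *m A) 0 j).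
Proof.
have -> : (fun x : 'rV[R]_n => (x *m A) 0 j) = (fun x => \sum_k x 0 k * A k j).
  by apply/funext => x; rewrite mxE.
apply: continuous_sumr => k x; apply: continuousM; first exact: coord_continuous.
exact: cst_continuous.
Qed.

Lemma continuous_dotv_mulmx (A : 'M[R]_n) : continuous (fun x => dotv x (x *m A)).
Proof.
apply: continuous_sumr => k x; apply: continuousM; first exact: coord_continuous.
exact: continuous_mulmx_coord.
Qed.
End Continuity.

(** * The solution in the positive orthant *)

Lemma quadform_shift (R : realType) (n : nat) (A : 'M[R]_n) (x : 'rV[R]_n) j s : A^T = A ->
  dotv (x + s *: delta_mx 0 j) ((x + s *: delta_mx 0 j) *m A) =
    dotv x (x *m A) + 2 * s * (x *m A) 0 j + s ^+ 2 * A j j.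
Proof.
move=> Asym; rewrite mulmxDl -scalemxAl !(dotvDl, dotvDr, dotvZl, dotvZr).
have -> : dotv x ((delta_mx 0 j : 'rV_n) *m A) = (x *m A) 0 j.
  by rewrite -dotv_delta dotv_mulmx Asym.
rewrite ![dotv (delta_mx 0 j) _]dotvC !dotv_delta.
have -> : ((delta_mx 0 j : 'rV_n) *m A) 0 j = A j j by rewrite -rowE mxE.
by ring.
Qed.

Lemma prod_shift (R : realType) (n : nat) (x : 'rV[R]_n) j s : x 0 j != 0 ->
  \prod_i (x + s *: delta_mx 0 j) 0 i = (1 + s / x 0 j) * \prod_i x 0 i.
Proof.
move=> xj0; rewrite (bigD1 j) //= [in RHS](bigD1 j) //= mulrA; congr (_ * _).
  by rewrite !mxE !eqxx mulr1; field.
by apply: eq_bigr => i ij; rewrite !mxE (negPf ij) andbF mulr0 addr0.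
Qed.

Section Orthant.
Variables (R : realType) (n : nat) (A : 'M[R]_n) (delta : R).
Hypotheses (A_sym : A^T = A) (delta_gt0 : 0 < delta).
Hypothesis A_coercive : forall x, delta * dotv x x <= dotv x (x *m A).
Implicit Types x y : 'rV[R]_n.
Let q x := dotv x (x *m A).

Lemma quadformZ s x : q (s *: x) = s ^+ 2 * q x.
Proof. by rewrite /q -scalemxAl dotvZl dotvZr mulrA. Qed.

Lemma coercive_coord x i : delta * x 0 i ^+ 2 <= q x.
Proof.
apply: le_trans (A_coercive x); rewrite ler_pM2l // dotvv (bigD1 i) //= lerDl.
by apply: sumr_ge0 => k _; exact: sqr_ge0.
Qed.

Lemma quadform_ge0 x : 0 <= q x.
Proof. by apply: le_trans (A_coercive x); rewrite mulr_ge0 ?dotvv_ge0 // ltW. Qed.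

(** Both sides of the last clause have degree 2n in [y], so maximality holds without the constraint
    [q y <= 1] and can be tested along coordinate axes. *)
Lemma orthant_maximizer : exists x : 'rV[R]_n,
  [/\ forall i, 0 < x 0 i, q x <= 1 &
      forall y : 'rV[R]_n, (forall i, 0 < y 0 i) ->
        (\prod_i y 0 i) ^+ 2 <= (\prod_i x 0 i) ^+ 2 * q y ^+ n].
Proof.
(* Coercivity gives y_i^2 <= 1 / delta when [q y <= 1], and t <= t^2 + 1. *)
pose M := delta^-1 + 1.
have M_bound y i : q y <= 1 -> y 0 i <= M.
  move=> qy; have := le_trans (coercive_coord y i) qy.
  rewrite -ler_pdivlMl // mulr1 => h; rewrite /M; nra.
have M_gt0 : 1 <= M by rewrite lerDr invr_ge0 ltW.
have fc : continuous (fun x : 'rV[R]_n => - \prod_i x 0 i).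
  by move=> x; apply: continuousN; apply: continuous_prodr => i; exact: coord_continuous.
have [||x [x0M qx xmax]] := @EVT_box R n _ q 0 M 1 fc.
- exact: continuous_dotv_mulmx.
- exists 0 => [i|]; first by rewrite mxE lexx (le_trans ler01).
  by rewrite /q mul0mx /dotv big1 ?ler01 // => i _; rewrite mxE mul0r.
have prodx_max y : (forall i, 0 <= y 0 i) -> q y <= 1 -> \prod_i y 0 i <= \prod_i x 0 i.
  by move=> y0 qy; rewrite -lerN2; apply: xmax => // i; rewrite y0 M_bound.
(* A small multiple of the all-ones vector is feasible, so the maximum is positive and [x] lies off
   the boundary of the orthant. *)
have prodx : 0 < \prod_i x 0 i.
  pose e : 'rV[R]_n := const_mx 1; pose s := (1 + q e)^-1.
  have qe := quadform_ge0 e.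
  have s0 : 0 < s by rewrite invr_gt0 ltr_pwDl.
  have sq : s * (1 + q e) = 1 by rewrite mulVf // gt_eqF // ltr_pwDl.
  apply: lt_le_trans (prodx_max (s *: e) _ _).
  - by apply: prodr_gt0 => i _; rewrite !mxE mulr1.
  - by move=> i; rewrite !mxE mulr1 ltW.
  - by rewrite quadformZ; nra.
have x_gt0 i : 0 < x 0 i.
  rewrite lt_neqAle eq_sym; case/andP: (x0M i) => -> _; rewrite andbT.
  by move: prodx; apply: contraTneq => xi; rewrite (bigD1 i) //= xi mul0r ltxx.
exists x; split=> // y y_gt0.
(* For n = 0 the form vanishes and [y] cannot be normalised; both sides are then 1. *)
have [n0|n_gt0] := posnP n.
  have E (z : 'rV[R]_n) : \prod_i z 0 i = 1.
    by rewrite big1 // => -[i hi]; exfalso; move: hi; rewrite n0.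
  by rewrite !E expr1n mul1r n0 expr0.
have qy : 0 < q y.
  apply: lt_le_trans (coercive_coord y (Ordinal n_gt0)).
  by rewrite mulr_gt0 // exprn_gt0.
pose r := Num.sqrt (q y); have r0 : 0 < r by rewrite sqrtr_gt0.
have r2 : r ^+ 2 = q y by rewrite sqr_sqrtr // ltW.
have := prodx_max (r^-1 *: y).
have -> : \prod_i (r^-1 *: y) 0 i = r^-1 ^+ n * \prod_i y 0 i.
  under eq_bigr do rewrite mxE.
  by rewrite big_split /= prodr_const card_ord.
rewrite quadformZ [r^-1 ^+ 2]exprVn r2 mulVf ?gt_eqF // => /(_ _ (lexx 1)) h.
rewrite -r2 -exprM mulnC exprM -exprMn ler_sqr ?nnegrE; first last.
- by rewrite mulr_ge0 ?exprn_ge0 ?ltW.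
- by rewrite ltW // prodr_gt0.
rewrite mulrC -ler_pdivrMl ?exprn_gt0 // -exprVn; apply: h => i.
by rewrite mxE mulr_ge0 ?invr_ge0 // ltW.
Qed.

(** The Lagrange condition at the maximiser is x_i (x A)_i = 1 / n for all i; scaling by sqrt n
    turns 1 / n into 1. *)
Lemma orthant_critical : exists x : 'rV[R]_n,
  forall i, 0 < x 0 i /\ x 0 i * (x *m A) 0 i = 1.
Proof.
have [x [x_gt0 qx xmax]] := orthant_maximizer.
suff xA i : n%:R * (x 0 i * (x *m A) 0 i) = 1.
  exists (Num.sqrt n%:R *: x) => i; have := xA i => h.
  have n0 : 0 < n%:R :> R by rewrite ltr0n (leq_ltn_trans (leq0n i) (ltn_ord i)).
  split; first by rewrite mxE mulr_gt0 ?sqrtr_gt0.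
  by rewrite -scalemxAl mxE [X in _ * X]mxE mulrACA -expr2 sqr_sqrtr ?h //.
have n_gt0 : (0 < n)%N by exact: leq_ltn_trans (leq0n i) (ltn_ord i).
have prodx : 0 < \prod_k x 0 k by apply: prodr_gt0.
(* Maximality tested at [x] itself forces [1 <= q x ^+ n]. *)
have qx1 : q x = 1.
  apply/eqP; rewrite eq_le qx /=; have := xmax x x_gt0.
  rewrite -[X in X <= _]mulr1 ler_pM2l ?exprn_gt0 // => h.
  rewrite leNgt; apply: contraTN h => h; rewrite -ltNge.
  by rewrite exprn_ilt1 ?quadform_ge0 // -lt0n.
set b : R := (x *m A) 0 i; have xi := x_gt0 i.
(* By homogeneity the maximality of x along the i-th axis reads h >= 0 near 0,
   with equality at 0. *)
pose h : {poly R} := (1 + (2 * b)%:P * 'X + (A i i)%:P * 'X^2) ^+ n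
                  - (1 + (x 0 i)^-1%:P * 'X) ^+ 2.
have hE s : h.[s] = (1 + 2 * b * s + A i i * s ^+ 2) ^+ n - (1 + s / x 0 i) ^+ 2.
  rewrite /h hornerD hornerN !horner_exp !hornerD !hornerM !hornerC !hornerX.
  by rewrite -expr2 [_ * s in X in - X]mulrC.
have : h^`().[0] = 0.
  (* On this interval the shifted point stays in the open orthant. *)
  apply: (@poly_min_deriv0 _ _ (- x 0 i) (x 0 i)); first by rewrite oppr_lt0 xi.
  move=> s /andP[s1 s2].
  rewrite !hE !mulr0 expr0n /= mulr0 mul0r !addr0 !expr1n subrr subr_ge0.
  have := xmax (x + s *: delta_mx 0 i).
  rewrite prod_shift ?gt_eqF // /q quadform_shift // -/(q x) qx1 -/b.
  rewrite [_ * \prod_k _]mulrC exprMn ler_pM2l ?exprn_gt0 //.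
  rewrite [2 * s * b]mulrAC [s ^+ 2 * _]mulrC; apply=> k.
  rewrite !mxE; have [->|ki] := eqVneq k i; first by rewrite eqxx mulr1; lra.
  by rewrite andbF mulr0 addr0.
rewrite /h derivB !deriv_exp !derivCE /=.
rewrite !(hornerD, hornerN, hornerMn, hornerM, horner_exp, hornerC, hornerX).
rewrite !(mulr0, mul0r, addr0, add0r, mulr1, expr1n) -[2 * b *+ n]mulr_natl => hb.
have -> : n%:R * (x 0 i * b) = 1 + (n%:R * (2 * b) - ((x 0 i)^-1 + (x 0 i)^-1)) * (x 0 i / 2).
  by field; rewrite gt_eqF.
by rewrite hb mul0r addr0.
Qed.
End Orthant.

(** * Solutions of bounded norm, for coercive and then semidefinite matrices *)

Section Coercive.
Variables (R : realType) (n : nat) (A : 'M[R]_n) (delta : R).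
Hypotheses (A_sym : A^T = A) (delta_gt0 : 0 < delta).
Hypothesis A_coercive : forall x, delta * dotv x x <= dotv x (x *m A).

(** Conjugation by the sign matrix [E] preserves symmetry and coercivity and carries the orthant of
    [S] to the positive one. *)
Lemma signed_critical (S : {set 'I_n}) : exists x : 'rV[R]_n,
  (forall i, x 0 i * (x *m A) 0 i = 1) /\ (forall i, (0 < x 0 i) = (i \in S)).
Proof.
pose e : 'rV[R]_n := \row_i (if i \in S then 1 else -1).
have e2 i : e 0 i * e 0 i = 1 by rewrite mxE; case: ifP => _; rewrite ?mulrNN mul1r.
pose E := diag_mx e.
have EE : E *m E = 1%:M.
  rewrite mulmx_diag -diag_const_mx; congr diag_mx.
  by apply/rowP => i; rewrite [LHS]mxE e2 mxE.
have [||y y_sol] := @orthant_critical R n (E *m A *m E) delta _ delta_gt0.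
- by rewrite !trmx_mul !tr_diag_mx A_sym mulmxA.
- move=> y; rewrite !mulmxA dotv_diag; apply: le_trans (A_coercive _).
  by rewrite dotv_diag -mulmxA EE mulmx1.
have yE i : (y *m E) 0 i = y 0 i * e 0 i by rewrite mul_mx_diag mxE.
exists (y *m E); split=> i; have [y0 yi] := y_sol i; rewrite yE.
  by rewrite -yi !mulmxA [in RHS]mul_mx_diag [in RHS]mxE -mulrA [e 0 i * _]mulrC.
by rewrite mxE; case: ifP => _; rewrite ?mulr1 // mulrN1 oppr_gt0 ltNge ltW.
Qed.

Lemma coercive_critical_bounded : (forall k, 1 <= A k k) -> exists x : 'rV[R]_n,
  (forall i, x 0 i * (x *m A) 0 i = 1) /\ dotv x x <= n%:R.
Proof.
move=> A_diag.
pose p S := sval (cid (signed_critical S)).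
have p_sol S i : p S 0 i * (p S *m A) 0 i = 1 by have [] := svalP (cid (signed_critical S)).
have p_sgn S i : (0 < p S 0 i) = (i \in S) by have [] := svalP (cid (signed_critical S)).
have p_inj : injective p by move=> S T pST; apply/setP => i; rewrite -!p_sgn pST.
have Apos : posdef R n A.
  by move=> x x0; apply: lt_le_trans (A_coercive x); rewrite mulr_gt0 ?dotvv_gt0.
have wpos S := posdef_weight_gt0 _ _ _ _ Apos (p_sol S).
have J0 S : \det (diag_mx (p S *m A) + A *m diag_mx (p S)) != 0.
  by apply: contraTneq (wpos S) => ->; rewrite mul0r ltxx.
pose w S := (\det (diag_mx (p S *m A) + A *m diag_mx (p S)) * \prod_i p S 0 i)^-1.
have w1 : \sum_S w S = 1 := sol_weight_sum1 _ _ _ _ p_sol p_inj J0.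
have w2 k : A k k * \sum_S w S * p S 0 k ^+ 2 = 1 :=
  sol_weight_sum_sqr _ _ _ _ p_sol p_inj J0 k.
have {}wpos S : 0 < w S by rewrite invr_gt0.
apply: contrapT => nosol.
have large S : n%:R < dotv (p S) (p S).
  by rewrite ltNge; apply/negP => h; apply: nosol; exists (p S).
have : \sum_S w S * n%:R < \sum_S w S * dotv (p S) (p S).
  apply: ltr_sum => [|S _]; last by rewrite ltr_pM2l.
  (* Strictness of the sum needs at least one index. *)
  by apply/hasP; exists finset.set0; rewrite ?mem_index_enum.
rewrite -mulr_suml w1 mul1r ltNge => /negP; apply.
under eq_bigr do rewrite dotvv mulr_sumr.
rewrite exchange_big /= -[X in _ <= X%:R]card_ord -sumr_const.
(* The weighted mean of x_k^2 is at most [A k k] times itself, which is 1. *)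
apply: ler_sum => k _; rewrite -(w2 k) ler_peMl //.
by apply: sumr_ge0 => S _; rewrite mulr_ge0 ?sqr_ge0 // ltW.
Qed.

End Coercive.

(** In place of a convergent subsequence, the residual [f] is minimised over the ball |x|^2 <= n;
    solutions for A + d I make it arbitrarily small, so its minimum is 0. *)
Lemma psd_critical_bounded (R : realType) (n : nat) (A : 'M[R]_n) :
  A^T = A -> (forall x, 0 <= dotv x (x *m A)) -> (forall k, 1 <= A k k) ->
  exists x : 'rV[R]_n, (forall i, x 0 i * (x *m A) 0 i = 1) /\ dotv x x <= n%:R.
Proof.
move=> A_sym A_psd A_diag.
pose f (x : 'rV[R]_n) := \sum_i (x 0 i * (x *m A) 0 i - 1) ^+ 2.
have bound (x : 'rV[R]_n) i : dotv x x <= n%:R -> x 0 i ^+ 2 <= n%:R.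
  apply: le_trans; rewrite dotvv (bigD1 i) //= lerDl.
  by apply: sumr_ge0 => k _; exact: sqr_ge0.
have box (x : 'rV[R]_n) i : dotv x x <= n%:R -> - (n%:R + 1) <= x 0 i <= n%:R + 1.
  by move=> /bound => /(_ i); have : 0 <= n%:R :> R by []; nra.
(* A solution for A + d I has residuals - d x_i^2 with x_i^2 <= n, so [f] is at most n (d n)^2. *)
have approx d : 0 < d -> exists2 x : 'rV[R]_n, dotv x x <= n%:R & f x <= d ^+ 2 * n%:R ^+ 3.
  move=> d0; have [|||x [x_sol xn]] := @coercive_critical_bounded R n (A + d%:M) d _ d0.
  - by rewrite linearD /= A_sym tr_scalar_mx.
  - by move=> x; rewrite mulmxDr mul_mx_scalar dotvDr dotvZr lerDr.
  - by move=> k; rewrite !mxE eqxx (le_trans (A_diag k)) // lerDl ltW.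
  exists x => //; rewrite /f [_ ^+ 3]exprS mulrCA mulr_natl -[X in _ *+ X]card_ord -sumr_const.
  apply: ler_sum => i _.
  have -> : x 0 i * (x *m A) 0 i - 1 = - (d * x 0 i ^+ 2).
    by have := x_sol i; rewrite mulmxDr mul_mx_scalar !mxE => <-; ring.
  rewrite sqrrN exprMn ler_pM2l ?exprn_gt0 // ler_sqr ?nnegrE ?sqr_ge0 //.
  exact: bound.
have [|||x [_ xn xmin]] := @EVT_box R n f (fun x => dotv x x) (- (n%:R + 1)) (n%:R + 1) n%:R.
- apply: continuous_sumr => i.
  have hc : continuous ((fun x : 'rV[R]_n => x 0 i * (x *m A) 0 i) - cst 1).
    move=> x; apply: continuousB; last exact: cst_continuous.
    by apply: continuousM; [exact: coord_continuous|exact: continuous_mulmx_coord].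
  by move=> x; exact: (continuousM (hc x) (hc x)).
- by apply: continuous_sumr => i x; apply: continuousM; exact: coord_continuous.
- by have [x xn _] := approx 1 ltr01; exists x => // i; exact: box.
have f_ge0 : 0 <= f x by apply: sumr_ge0 => i _; exact: sqr_ge0.
have f0 : f x = 0.
  apply/eqP; rewrite eq_le f_ge0 andbT leNgt; apply/negP => f_gt0.
  pose N : R := n%:R ^+ 3; have N0 : 0 <= N by rewrite exprn_ge0.
  (* Chosen so that d < 1 and d N < [f x], hence d^2 N < [f x], against minimality. *)
  pose d := f x / (f x + N + 1).
  have D0 : 0 < f x + N + 1 by lra.
  have dD : d * (f x + N + 1) = f x by rewrite divfK // gt_eqF.
  have d0 : 0 < d by rewrite divr_gt0.
  have [y yn fy] := approx d d0.
  have := le_trans (xmin y (fun i => box y i yn) yn) fy; rewrite -/N.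
  have d1 : d < 1 by rewrite ltr_pdivrMr //; lra.
  nra.
exists x; split=> // i; apply/eqP; rewrite -subr_eq0 -sqrf_eq0.
move: f0 => /eqP; rewrite psumr_eq0 => [/allP/(_ i)|k _]; last exact: sqr_ge0.
by rewrite mem_index_enum => /(_ isT).
Qed.

(** * From the Gram matrix to the unit vector *)

Theorem theorem1 (R : realType) (n d : nat) (hn : (1 <= n)%N) (hd : (1 <= d)%N)
    (u : 'I_n -> 'rV[R]_d) (hu : forall i : 'I_n, unit_vector (u i)) :
  exists v : 'rV[R]_d,
    [/\ unit_vector v,
        forall i : 'I_n, dotv (u i) v <> 0
      & \sum_(i < n) 1 / dotv (u i) v ^+ 2 <= n%:R ^+ 2].
Proof.
(* The rows are the [u i], so [U *m U^T] is the Gram matrix and [y *m U] the combination with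
   coefficients [y]. *)
pose U := \matrix_i u i.
have UE i y : dotv (u i) (y *m U) = (y *m (U *m U^T)) 0 i.
  by rewrite mulmxA -dotv_delta dotv_mulmx trmxK -rowE rowK dotvC.
have u1 i : dotv (u i) (u i) = 1.
  have := hu i; rewrite /unit_vector /enorm => /(congr1 (fun r => r ^+ 2)).
  by rewrite sqr_sqrtr ?dotvv_ge0 // expr1n.
have psd (y : 'rV[R]_n) : dotv y (y *m (U *m U^T)) = dotv (y *m U) (y *m U).
  by rewrite mulmxA -dotv_mulmx.
have [|||x [x_sol xn]] := @psd_critical_bounded R n (U *m U^T).
- by rewrite trmx_mul trmxK.
- by move=> y; rewrite psd dotvv_ge0.
- by move=> k; rewrite -(u1 k) mxE le_eqVlt; apply/orP/or_introl/eqP/eq_bigr => j _; rewrite !mxE.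
pose r : R := Num.sqrt n%:R.
have r2 : r ^+ 2 = n%:R by rewrite sqr_sqrtr.
have r0 : r != 0 by rewrite sqrtr_eq0 -ltNge ltr0n.
have x0 i : x 0 i != 0.
  by apply/eqP => xi; have /eqP := x_sol i; rewrite xi mul0r eq_sym oner_eq0.
have uv i : dotv (u i) (r^-1 *: (x *m U)) = (r * x 0 i)^-1.
  rewrite dotvZr UE invfM; congr (_ * _); apply: (mulfI (x0 i)).
  by rewrite x_sol divff.
exists (r^-1 *: (x *m U)); split.
(* The squared norm of [x *m U] is the sum of the n terms x_i (x A)_i = 1. *)
- rewrite /unit_vector /enorm dotvZr dotvZl -psd mulrA -expr2 exprVn r2.
  rewrite /dotv (eq_bigr (fun=> 1)) => [|i _]; last exact: x_sol.
  by rewrite sumr_const card_ord mulVf ?sqrtr1 // pnatr_eq0 -lt0n.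
- by move=> i; apply/eqP; rewrite uv invr_eq0 mulf_neq0.
- under eq_bigr do rewrite uv div1r exprVn invrK exprMn r2.
  by rewrite -mulr_sumr expr2 ler_pM2l // ltr0n.
Qed.
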